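(* Let $G$ be the symmetric group $S_5$ and let $N$ be the alternating group $A_5$, so $N\unlhd G$. Then $m_{G,N}=0$.
   Context: For a finite group $G$ and $N\unlhd G$, set $$m_{G,N}:=\frac{1}{|G|}\sum_{X\leq G,\ XN=G}|X|\,\mu(X,G),$$ where $\mu$ is the Möbius function of the poset of subgroups of $G$ ordered by inclusion. *)

(* Defs.v *)
From mathcomp Require Import all_boot all_order all_algebra all_fingroup all_solvable.

Set Implicit Arguments.
Unset Strict Implicit.
Unset Printing Implicit Defensive.

Import GRing.Theory GroupScope.
Local Open Scope ring_scope.

Section Mobius.
Variable gT : finGroupType.
Implicit Types (X Y Z G N : {group gT}).

(* Recursion of depth n for mu(X, X) = 1, mu(X, Z) = - sum_(X <= Y < Z) mu(X, Y)
   and mu(X, Z) = 0 if X is not contained in Z.  Orders strictly decrease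
   along Y \proper Z, so depth #|Z| suffices; see subgroup_mobiusE. *)
Fixpoint subgroup_mobius_rec (n : nat) (X Z : {group gT}) : int :=
  if n is m.+1 then
    if X == Z then 1
    else if X \subset Z then
      - \sum_(Y : {group gT} | (X \subset Y) && (Y \proper Z))
          subgroup_mobius_rec m X Y
    else 0
  else 0.

Definition subgroup_mobius X Z : int := subgroup_mobius_rec #|Z| X Z.

Lemma subgroup_mobius_rec_stable n X Z :
  (#|Z| <= n)%N -> subgroup_mobius_rec n X Z = subgroup_mobius X Z.
Proof.
suffices stable m : (#|Z| <= m)%N -> (#|Z| <= n)%N ->
    subgroup_mobius_rec n X Z = subgroup_mobius_rec m X Z.
  exact: stable (leqnn _).
elim: n m Z => [|n IHn] [|m] Z //= leZm leZn.
- by have:= cardG_gt0 Z; rewrite ltnNge leZn.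
- by have:= cardG_gt0 Z; rewrite ltnNge leZm.
case: ifP => // _; case: ifP => // _; congr (- _).
apply: eq_bigr => Y /andP[_ /proper_card ltYZ].
by apply: IHn; rewrite -ltnS; apply: leq_trans ltYZ _.
Qed.

Lemma subgroup_mobiusE X Z :
  subgroup_mobius X Z =
    if X == Z then 1
    else if X \subset Z then
      - \sum_(Y : {group gT} | (X \subset Y) && (Y \proper Z))
          subgroup_mobius X Y
    else 0.
Proof.
rewrite -(subgroup_mobius_rec_stable X (leqnSn #|Z|)) /=.
case: ifP => // _; case: ifP => // _; congr (- _).
apply: eq_bigr => Y /andP[_ /proper_card/ltnW leYZ].
exact: subgroup_mobius_rec_stable.
Qed.

Lemma subgroup_mobius_sum X Z : X \subset Z ->
  \sum_(Y : {group gT} | (X \subset Y) && (Y \subset Z)) subgroup_mobius X Y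
    = (X == Z)%:R.
Proof.
move=> sXZ; rewrite (bigD1 Z) ?sXZ ?subxx //= subgroup_mobiusE sXZ.
under eq_bigl => Y.
  rewrite -andbA (_ : _ && (Y != Z) = (Y \proper Z)); first over.
  by rewrite properEneq andbC.
case: eqP => [<-|_]; last by rewrite addNr.
rewrite big_pred0 ?addr0 // => Y.
by rewrite properE; case: (X \subset Y); rewrite ?andbF.
Qed.

Definition m_coef G N : rat :=
  #|G|%:R^-1 *
  \sum_(X : {group gT} | (X \subset G) && (X * N == G)%g)
     #|X|%:R * (subgroup_mobius X G)%:~R.

End Mobius.

(* Main.v *)
Require Import Defs.
From mathcomp Require Import all_boot all_order all_algebra all_fingroup all_solvable.

(** If [G / N] is cyclic, generated by [N x], then a subgroup [X] of [G] meets
    the coset [N x] iff [X N = G], and then [#|X| = #|G : N| * #|X :&: N x|].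
    Hence [m_coef G N] is, up to a nonzero factor, the sum over [y] in [N x] of
    [\sum_(<[y]> <= X <= G) mu(X, G)], which by Moebius inversion counts the [y]
    in [N x] that generate [G].  There are none when [G] is not cyclic. *)

Import GRing.Theory.
Local Open Scope ring_scope.

Lemma subgroup_mobius_eq0 (gT : finGroupType) (X Z : {group gT}) :
  ~~ (X \subset Z) -> subgroup_mobius X Z = 0.
Proof.
move=> nsXZ; rewrite subgroup_mobiusE (negPf nsXZ).
by case: eqP nsXZ => // ->; rewrite subxx.
Qed.

(* [subgroup_mobius_sum] says that mu is a left inverse of the zeta matrix of
   the subgroup poset; for square matrices it is then also a right inverse. *)
Lemma subgroup_mobius_suml (gT : finGroupType) (X Z : {group gT}) :
  \sum_(Y : {group gT} | (X \subset Y) && (Y \subset Z)) subgroup_mobius Y Z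
    = (X == Z)%:R.
Proof.
pose gr := @enum_val {group gT} predT.
have grK : cancel enum_rank gr by exact: enum_rankK.
pose zeta : 'M[int]_#|{group gT}| := \matrix_(i, j) (gr i \subset gr j)%:R.
pose mu : 'M[int]_#|{group gT}| := \matrix_(i, j) subgroup_mobius (gr i) (gr j).
have sum_gr (F : {group gT} -> int) : \sum_i F (gr i) = \sum_Y F Y.
  by rewrite (reindex gr) //; apply/onW_bij/enum_val_bij.
(* Entrywise this is [subgroup_mobius_sum]: a product of entries vanishes unless [Y] lies between
   [gr i] and [gr j]. *)
have mu_zeta : mu *m zeta = 1%:M.
  apply/matrixP=> i j; rewrite !mxE.
  under eq_bigr do rewrite !mxE.
  rewrite (sum_gr (fun Y => subgroup_mobius (gr i) Y * (Y \subset gr j)%:R)).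
  rewrite -(inj_eq (@enum_val_inj _ predT) i j) -/gr.
  have [sij | nsij] := boolP (gr i \subset gr j).
    rewrite -subgroup_mobius_sum // [RHS]big_mkcond /=; apply: eq_bigr => Y _.
    have [siY | nsiY] := boolP (gr i \subset Y).
      by case: (Y \subset gr j); rewrite ?mulr1 ?mulr0.
    by rewrite subgroup_mobius_eq0 // mul0r.
  rewrite big1 => [|Y _].
    by case: eqP nsij => // ->; rewrite subxx.
  have [siY | nsiY] := boolP (gr i \subset Y).
    have [sYj | _] := boolP (Y \subset gr j); last by rewrite mulr0.
    by rewrite (subset_trans siY sYj) in nsij.
  by rewrite subgroup_mobius_eq0 // mul0r.
have /matrixP/(_ (enum_rank X) (enum_rank Z)) := mulmx1C mu_zeta.
rewrite !mxE (inj_eq enum_rank_inj) => <-.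
under [RHS]eq_bigr do rewrite !mxE !grK.
rewrite (sum_gr (fun Y => (X \subset Y)%:R * subgroup_mobius Y Z)) big_mkcond.
apply: eq_bigr => Y _; case: (X \subset Y); rewrite ?mul0r ?mul1r //=.
by case: ifPn => // /subgroup_mobius_eq0->.
Qed.

(** A nonempty intersection is a coset of [X :&: N], whose order follows from the product formula
    for [X * N]. *)
Lemma card_setI_rcoset (gT : finGroupType) (G N X : {group gT}) (x : gT) :
    (N <| G)%g -> x \in G -> (G / N)%g = <[coset N x]>%g -> X \subset G ->
  (#|G : N|%g * #|X :&: (N :* x)%g|)%N = if (X * N == G)%g then #|X| else 0%N.
Proof.
move=> nsNG Gx genGN sXG; have [sNG nNG] := andP nsNG.
have nNX := subset_trans sXG nNG.
have [meetX | /set0Pn[y /setIP[Xy Nxy]]] := eqVneq (X :&: (N :* x)%g) set0.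
  rewrite meetX cards0 muln0; case: eqP => // defG.
  have: x \in (N * X)%g by rewrite -normC ?defG.
  case/mulsgP=> n y Nn Xy def_x.
  have: y \in X :&: (N :* x)%g.
    by rewrite inE Xy mem_rcoset def_x invMg mulKVg groupV.
  by rewrite meetX inE.
(* As [y] lies in both [X] and [N x], the image of [X] in [G / N] contains the generator
   [coset N x]. *)
have defG : (X * N)%g = G.
  apply/eqP; rewrite eqEsubset mul_subG //= normC //.
  rewrite -quotientSK // genGN cycle_subG.
  have <- : coset N y = coset N x.
    exact/(rcoset_kercosetP (subsetP nNX y Xy) (subsetP nNG x Gx)).
  exact: mem_quotient.
rewrite defG eqxx -(rcoset_eqP Nxy).
have -> : X :&: (N :* y)%g = ((X :&: N) :* y)%g.
  by apply/setP=> z; rewrite inE !mem_rcoset inE [in RHS]groupMr ?groupV.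
(* Multiplying by [#|N|] turns the index into [#|G|], that is, [#|X * N|]. *)
apply/eqP; rewrite card_rcoset -(@eqn_pmul2l #|N|) ?cardG_gt0 // mulnA Lagrange //.
by rewrite [eqbRHS]mulnC mul_cardG defG.
Qed.

Lemma m_coef_eq0 (gT : finGroupType) (G N : {group gT}) :
  (N <| G)%g -> cyclic (G / N)%g -> ~~ cyclic G -> m_coef G N = 0.
Proof.
move=> nsNG /cyclicP[Nx genGN] ncycG; have [sNG nNG] := andP nsNG.
have /morphimP[x Nnx Gx def_Nx] : Nx \in (G / N)%g by rewrite genGN cycle_id.
rewrite {}def_Nx in genGN.
suff count0 : \sum_(X : {group gT} | X \subset G)
    #|X :&: (N :* x)%g|%:R * subgroup_mobius X G = 0.
  rewrite /m_coef [X in _ * X](_ : _ = 0) ?mulr0 //.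
  transitivity (#|G : N|%g%:R * (\sum_(X : {group gT} | X \subset G)
      #|X :&: (N :* x)%g|%:R * subgroup_mobius X G)%:~R : rat); last first.
    by rewrite count0 mulr0.
  rewrite rmorph_sum mulr_sumr big_mkcondr /=; apply: eq_bigr => X sXG.
  rewrite rmorphM /= rmorph_nat mulrA -natrM card_setI_rcoset //.
  by case: ifP; rewrite ?mul0r.
(* Double counting: [y] lies in [X] iff [<[y]>] is contained in [X]. *)
transitivity (\sum_(y in (N :* x)%g)
    \sum_(X : {group gT} | (<[y]>%g \subset X) && (X \subset G))
      subgroup_mobius X G).
  rewrite (exchange_big_dep (fun X : {group gT} => X \subset G)) /=.
    apply: eq_bigr => X sXG; rewrite sumr_const mulr_natl; congr (_ *+ _).
    by apply: eq_card => y; rewrite inE [RHS]unfold_in sXG cycle_subG andbT andbC.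
  by move=> y X _ /andP[].
(* The inner sum is 1 if [y] generates [G] and 0 otherwise. *)
apply: big1 => y _; rewrite (@subgroup_mobius_suml _ <[y]>%G).
by case: eqP ncycG => // <-; rewrite cycle_cyclic.
Qed.

Theorem proposition7p3 : m_coef 'Sym_('I_5)%G 'Alt_('I_5)%G = 0.
Proof.
apply: m_coef_eq0; first exact: Alt_normal.
  (* The quotient has prime order 2. *)
  by apply: prime_cyclic; rewrite card_quotient ?Alt_norm // Alt_index ?card_ord.
(* If [S_5] were cyclic, its subgroup [A_5] would be solvable. *)
apply/negP => /cyclic_abelian/abelian_sol/(solvableS (Alt_subset 'I_5)).
by rewrite solvable_AltF ?card_ord.
Qed.
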